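(* Let $N\ge 3$. For any dimension $d\ge 3$, there exist linearly independent, symmetric and pairwise commuting measurement matrices $A_1,\dots,A_m\in\mathbb{R}^{d\times d}$ and corresponding labels $y_1,\dots,y_m\in\mathbb{R}$ (of the form $y_i = \langle A_i, W^*\rangle$ for some $W^*\in\mathcal{S}_+^d$), such that the following holds with $\ell(W)=\frac12\sum_{i=1}^m(y_i-\langle A_i,W\rangle)^2$ and with $\bar W_{\mathrm{deep}}$ the limit solution defined in the context. Provided that $\bar W_{\mathrm{deep}}$ exists and is a global optimum of $\min_{W\in\mathcal{S}_+^d}\ell(W)$ with $\ell(\bar W_{\mathrm{deep}})=0$, the matrix $\bar W_{\mathrm{deep}}$, which satisfies $\bar W_{\mathrm{deep}}\in\operatorname*{argmin}_{W\in\mathcal{S}_+^d,\ \ell(W)=0}\|W\|_*$, is, for every $0<p<1$, not a local minimum of the program $$\min_{W\in\mathcal{S}_+^d,\ \ell(W)=0}\|W\|_{S_p}.$$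
   Context: $\mathcal{S}_+^d$ is the set of symmetric positive semidefinite matrices in $\mathbb{R}^{d\times d}$; $\langle A,B\rangle=\mathrm{tr}(A^\top B)$; $\|\cdot\|_*$ is the nuclear norm. For $0<p\le 1$ the Schatten-$p$ quasi-norm is given by $\|W\|_{S_p}^p = \sum_{r}\sigma_r(W)^p$, where $\sigma_r(W)$ are the singular values of $W$. Local minimum is meant relative to the feasible set $\{W\in\mathcal{S}_+^d:\ell(W)=0\}$. Limit solution: define $\phi(W_1,\dots,W_N) := \ell(W_N\cdots W_1)$ for $W_1,\dots,W_N\in\mathbb{R}^{d\times d}$. For $\alpha>0$ let $W_1(t),\dots,W_N(t)$, $t\ge0$, solve $\dot W_j(t) = -\frac{\partial\phi}{\partial W_j}(W_1(t),\dots,W_N(t))$ with $W_j(0)=\alpha I$ for all $j$. Put $W_{\mathrm{deep},\infty}(\alpha) := \lim_{t\to\infty}W_N(t)\cdots W_1(t)$ and $\bar W_{\mathrm{deep}} := \lim_{\alpha\to0^+}W_{\mathrm{deep},\infty}(\alpha)$. *)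

(* Defs.v *)
From mathcomp Require Import all_boot all_order all_algebra.
From mathcomp Require Import complex.
From mathcomp Require Import all_classical all_reals all_analysis.
Import Order.TTheory GRing.Theory Num.Theory numFieldNormedType.Exports.

Set Implicit Arguments.
Unset Strict Implicit.
Unset Printing Implicit Defensive.

Local Open Scope classical_set_scope.
Local Open Scope ring_scope.

Section Matrices.
Context {R : realType} {d : nat}.
Implicit Types A B W : 'M[R]_d.

Definition psd : set 'M[R]_d :=
  [set W | W^T = W /\ forall x : 'cV[R]_d, 0 <= (x^T *m W *m x) 0 0].

Definition frob A B : R := \tr (A^T *m B).

(* The complex eigenvalues, repeated according to algebraic multiplicity:
   [closed_field_poly_normal] splits the characteristic polynomial. *)
Definition eigenvalues A : seq R[i] :=
  sval (closed_field_poly_normal (char_poly (map_mx (real_complex R) A))).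

(* The eigenvalues of W^T W are real and nonnegative, so [Re] only changes
   their type. *)
Definition singular_values W : seq R :=
  [seq Num.sqrt (complex.Re z) | z <- eigenvalues (W^T *m W)].

Definition nuclear_norm W : R := \sum_(s <- singular_values W) s.

Definition schatten (p : R) W : R :=
  (\sum_(s <- singular_values W) s `^ p) `^ p^-1.

End Matrices.

Section Optimization.
Context {R : realType}.

Definition argmin {T : Type} (F : set T) (f : T -> R) : set T :=
  [set x | F x /\ forall y, F y -> f x <= f y].

Definition local_min {T : topologicalType} (F : set T) (f : T -> R) : set T :=
  [set x | F x /\ \forall y \near within F (nbhs x), f x <= f y].

End Optimization.

Section Loss.
Context {R : realType} {d m : nat}.
Variables (A : 'I_m -> 'M[R]_d) (y : 'I_m -> R).

Definition loss (W : 'M[R]_d) : R :=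
  2^-1 * \sum_(i < m) (y i - frob (A i) W) ^+ 2.

Definition feasible : set 'M[R]_d := [set W | psd W /\ loss W = 0].

End Loss.

Section DeepFlow.
Context {R : realType} {d N : nat}.
Implicit Type Ws : 'I_N -> 'M[R]_d.

(* W_N ... W_1, the factor W_j being [Ws] at the ordinal j - 1. *)
Definition end_to_end Ws : 'M[R]_d :=
  \big[mulmx/1%:M]_(j < N) Ws (rev_ord j).

Definition deep_loss (l : 'M[R]_d -> R) Ws : R := l (end_to_end Ws).

(* The matrix of partial derivatives with respect to the entries of W_j. *)
Definition partial_grad (phi : ('I_N -> 'M[R]_d) -> R) (j : 'I_N) Ws : 'M[R]_d :=
  \matrix_(a, b)
    derive1 (fun s : R => phi [eta Ws with j |-> Ws j + s *: delta_mx a b]) 0.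

(* Derivative relative to the half-line t >= 0 (one-sided at t = 0). *)
Definition has_derivative_ge0 (f : R -> 'M[R]_d) (t : R) (v : 'M[R]_d) : Prop :=
  (s - t)^-1 *: (f s - f t) @[s --> within [set s | 0 <= s] t^'] --> v.

Definition gradient_flow (l : 'M[R]_d -> R) (alpha : R)
    (Ws : R -> 'I_N -> 'M[R]_d) : Prop :=
  (forall j, Ws 0 j = alpha%:M) /\
  (forall (t : R) j, 0 <= t ->
     has_derivative_ge0 (Ws ^~ j) t (- partial_grad (deep_loss l) j (Ws t))).

End DeepFlow.

Section LimitSolution.
Context {R : realType} {d : nat}.
Variables (N : nat) (l : 'M[R]_d -> R).

Definition is_W_deep_infty (alpha : R) (L : 'M[R]_d) : Prop :=
  exists2 Ws : R -> 'I_N -> 'M[R]_d,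
    gradient_flow l alpha Ws & end_to_end (Ws t) @[t --> +oo] --> L.

(* "The iterated limit exists and equals [Wbar]". *)
Definition is_W_deep_bar (Wbar : 'M[R]_d) : Prop :=
  exists2 Winf : R -> 'M[R]_d,
    (\forall alpha \near 0^'+, is_W_deep_infty alpha (Winf alpha)) &
    Winf alpha @[alpha --> 0^'+] --> Wbar.

End LimitSolution.

(* Main.v *)
(** A single measurement suffices: [A_1 = I] with [y_1 = d], so that feasibility
    means [W] psd with [tr W = d].  The nuclear norm equals the trace on psd
    matrices, hence is constant on the feasible set.  Every solution of the
    gradient flow started at multiples of the identity stays scalar: the
    deviations of the factors from being scalar grow at most linearly in
    themselves on bounded time intervals, so they vanish by Gronwall.  The limit
    solution is therefore the identity, which is no local minimum of the
    Schatten quasi-norm, because [x `^ p] lies strictly below its tangent at 1: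
    spreading two eigenvalues to [1 + e] and [1 - e] decreases the sum. *)

Require Import Defs.
From mathcomp Require Import all_boot all_order all_algebra.
From mathcomp Require Import complex ring lra.
From mathcomp Require Import all_classical all_reals all_analysis.
Import Order.TTheory GRing.Theory Num.Theory numFieldNormedType.Exports.

Set Implicit Arguments.
Unset Strict Implicit.
Unset Printing Implicit Defensive.

Local Open Scope classical_set_scope.
Local Open Scope ring_scope.

(** * Singular values of positive semidefinite matrices *)

Lemma char_poly_conj (F : fieldType) (n : nat) (P A : 'M[F]_n) :
  P \in unitmx -> char_poly (invmx P *m A *m P) = char_poly A.
Proof.
move=> Pu; rewrite /char_poly.
have -> : char_poly_mx (invmx P *m A *m P) =
    map_mx polyC (invmx P) *m char_poly_mx A *m map_mx polyC P.
  rewrite /char_poly_mx mulmxBr mulmxBl !map_mxM; congr (_ - _).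
  by rewrite scalar_mxC -mulmxA -map_mxM mulVmx// map_mx1 mulmx1.
by rewrite !det_mulmx mulrC mulrA -det_mulmx -map_mxM mulmxV// map_mx1 det1 mul1r.
Qed.

(** Over [R[i]] two factorizations into monic linear factors agree up to order, and [Num.sqrt]
    recovers each [x] from its square because [x] is nonnegative. *)
Lemma singular_values_char_poly (R : realType) (d : nat) (W : 'M[R]_d)
    (s : seq R) :
  {in s, forall x, 0 <= x} ->
  char_poly (W^T *m W) = \prod_(x <- s) ('X - (x ^+ 2)%:P) ->
  perm_eq (singular_values W) s.
Proof.
move=> s0 Ws; rewrite /singular_values /eigenvalues.
case: closed_field_poly_normal => r /=.
rewrite (monicP (char_poly_monic _)) scale1r -map_char_poly Ws rmorph_prod /=.
under eq_bigr do rewrite rmorphB /= map_polyX map_polyC /=.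
rewrite -(big_map (fun x : R => real_complex R (x ^+ 2)) xpredT
  (fun z => 'X - z%:P)) => /prod_XsubC_eq; rewrite perm_sym => rs.
rewrite (perm_trans (perm_map _ rs))// -map_comp.
rewrite (_ : map _ _ = s)//; rewrite -[RHS]map_id; apply/eq_in_map => x xs /=.
by rewrite sqrtr_sqr ger0_norm// s0.
Qed.

Lemma singular_values_diag (R : realType) (d : nat) (v : 'rV[R]_d) :
  (forall i, 0 <= v 0 i) ->
  perm_eq (singular_values (diag_mx v)) [seq v 0 i | i <- enum 'I_d].
Proof.
move=> v0; apply: singular_values_char_poly => [_ /mapP[i _ ->]//|].
rewrite tr_diag_mx mulmx_diag char_poly_trig ?diag_mx_is_trig//.
rewrite big_map big_enum/=; apply: eq_bigr => i _.
by rewrite !mxE eqxx mulr1n expr2.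
Qed.

(** At an eigenvector the quadratic form equals [a] times a positive sum of squares. *)
Lemma psd_eigenvalue_ge0 (R : realType) (d : nat) (W : 'M[R]_d) (a : R) :
  psd W -> eigenvalue W a -> 0 <= a.
Proof.
move=> [_ W0] /eigenvalueP[v vW v0].
have := W0 v^T; rewrite trmxK vW -scalemxAl mxE.
have vv : (v *m v^T) 0 0 = \sum_i v 0 i ^+ 2.
  by rewrite mxE; apply: eq_bigr => i _; rewrite mxE expr2.
suff vv0 : 0 < (v *m v^T) 0 0 by rewrite pmulr_lge0.
rewrite vv; rewrite lt_neqAle sumr_ge0 ?andbT; last by move=> i _; exact: sqr_ge0.
apply: contra v0; rewrite eq_sym psumr_eq0; last by move=> i _; exact: sqr_ge0.
move=> /allP vi; apply/eqP/rowP => i; rewrite mxE; apply/eqP.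
by rewrite -sqrf_eq0; exact: (vi _ (mem_index_enum i)).
Qed.

(** By the spectral theorem over [R[i]], [W] is similar to a real diagonal matrix. Hence the
    characteristic polynomials of [W] and of [W^T *m W] split over [R], with roots [l i] and their
    squares. Positivity makes the [l i] the singular values, and they sum to the trace. *)
Lemma nuclear_norm_psd (R : realType) (d : nat) (W : 'M[R]_d) :
  psd W -> nuclear_norm W = \tr W.
Proof.
move=> pW; have [Wsym _] := pW.
pose WC := map_mx (real_complex R) W.
have WCh : WC \is hermsymmx.
  apply/is_hermitianmxP; rewrite expr0 scale1r; apply/matrixP => i j.
  by rewrite !mxE -{1}Wsym mxE; apply/esym/CrealP; rewrite complex_real.
have /orthomx_spectralP := hermitian_normalmx WCh.
have Pu := spectral_unit WC.
move: (hermitian_spectral_diag_real WCh) Pu.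
move: (spectralmx WC) (spectral_diag WC) => P sp /mxOverP spR Pu WCE.
pose l i := complex.Re (sp 0 i).
have spE i : sp 0 i = real_complex R (l i) by rewrite RRe_real.
have prodE (f : R -> R) : \prod_(i < d) ('X - (real_complex R (f (l i)))%:P) =
    map_poly (real_complex R) (\prod_(x <- [seq l i | i <- enum 'I_d]) ('X - (f x)%:P)).
  rewrite big_map big_enum /= rmorph_prod; apply: eq_bigr => i _.
  by rewrite rmorphB /= map_polyX map_polyC.
have mapI : injective (map_poly (real_complex R)) by exact: map_poly_inj.
have cW : char_poly W = \prod_(x <- [seq l i | i <- enum 'I_d]) ('X - x%:P).
  apply: mapI; rewrite map_char_poly -/WC WCE char_poly_conj//.
  rewrite char_poly_trig ?diag_mx_is_trig// -(prodE id); apply: eq_bigr => i _.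
  by rewrite mxE eqxx mulr1n spE.
have cWW : char_poly (W^T *m W) =
    \prod_(x <- [seq l i | i <- enum 'I_d]) ('X - (x ^+ 2)%:P).
  apply: mapI; rewrite map_char_poly Wsym map_mxM -/WC WCE.
  rewrite !mulmxA mulmxK// -[_ *m diag_mx _ *m diag_mx _]mulmxA mulmx_diag.
  rewrite char_poly_conj// char_poly_trig ?diag_mx_is_trig//.
  rewrite -(prodE (fun x => x ^+ 2)); apply: eq_bigr => i _.
  by rewrite !mxE eqxx mulr1n spE -expr2 [in RHS](rmorphXn (real_complex R)).
have l0 : {in [seq l i | i <- enum 'I_d], forall x, 0 <= x}.
  move=> x xl; apply: (psd_eigenvalue_ge0 pW); rewrite eigenvalue_root_char cW.
  by rewrite root_prod_XsubC.
rewrite /nuclear_norm (perm_big _ (singular_values_char_poly l0 cWW)) /=.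
apply: (@complexI R); rewrite big_map big_enum /= rmorph_sum /=.
under eq_bigr do rewrite -spE.
transitivity (\tr WC); last by rewrite -trace_map_mx.
by rewrite WCE mxtrace_mulC mulmxA mulmxV// mul1mx mxtrace_diag.
Qed.

(** * Gronwall on the half-line *)

(** Scalar counterpart of [has_derivative_ge0], meant for the entries of the flow. *)
Definition derivative_ge0 (R : realType) (f : R -> R) (t v : R) : Prop :=
  (s - t)^-1 * (f s - f t) @[s --> within [set s | 0 <= s] t^'] --> v.

Lemma derivative_ge0_cvg (R : realType) (f : R -> R) (t v : R) :
  derivative_ge0 f t v ->
  f s @[s --> within [set s | 0 <= s] (nbhs t)] --> f t.
Proof.
move=> fv.
have st : s - t @[s --> within [set s | 0 <= s] t^'] --> (0 : R).
  rewrite -(subrr t); apply: cvgB; last exact: cvg_cst.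
  by apply: cvg_within_filter; apply: cvg_within_filter; exact: cvg_id.
have ft : (s - t) * ((s - t)^-1 * (f s - f t))
    @[s --> within [set s | 0 <= s] t^'] --> (0 : R).
  by rewrite -[X in _ --> X](mul0r v); exact: cvgM st fv.
apply/cvgrPdist_lt => e e0.
have /cvgrPdist_lt/(_ e e0) := ft.
rewrite !near_withinE; apply: filterS => s H s0.
have [->|st0] := eqVneq s t; first by rewrite subrr normr0.
have := H st0 s0; rewrite sub0r normrN /= mulrA mulfV ?subr_eq0// mul1r.
by rewrite distrC.
Qed.

(** Near a point [t > 0] the constraint [0 <= s] holds automatically, so the derivative is
    two-sided. *)
Lemma derivative_ge0_is_derive (R : realType) (f : R -> R) (t v : R) :
  0 < t -> derivative_ge0 f t v -> is_derive t 1 f v.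
Proof.
move=> t0 fv; apply/is_derive1_caratheodory.
exists (fun z => if z == t then v else (z - t)^-1 * (f z - f t)); split.
- move=> z; have [->|zt] := eqVneq; first by rewrite !subrr mulr0.
  by rewrite mulrAC mulVf ?mul1r// subr_eq0.
- apply/cvgrPdist_lt => e e0; rewrite eqxx.
  have /cvgrPdist_lt/(_ e e0) := fv; rewrite !near_withinE => H.
  have pos : \forall s \near t, 0 < s by exact: lt_nbhsr.
  move: pos H; apply: filterS2 => s s0 H /=.
  have [_|st0] := eqVneq s t; first by rewrite subrr normr0.
  exact: H st0 (ltW s0).
- by rewrite eqxx.
Qed.

Lemma derivative_ge0_within_continuous (R : realType) (f f' : R -> R) (T : R) :
  (forall t : R, 0 <= t -> derivative_ge0 f t (f' t)) ->
  {within `[0, T], continuous f}.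
Proof.
move=> ff'; apply/subspace_continuousP => t /=; rewrite in_itv/= => /andP[t0 _].
apply: (cvg_trans _ (derivative_ge0_cvg (ff' t t0))).
apply: cvg_app; apply: (@within_subset _ _ _ (nbhs t)) => s /=.
by rewrite in_itv/= => /andP[].
Qed.

Lemma derivative_ge0_sqr (R : realType) (f : R -> R) (t v : R) :
  derivative_ge0 f t v -> derivative_ge0 (fun s => f s ^+ 2) t (v * (f t *+ 2)).
Proof.
move=> fv; rewrite /derivative_ge0.
under eq_cvg do rewrite subr_sqr mulrA.
apply: cvgM; first exact: fv.
rewrite mulr2n; apply: cvgD; last exact: cvg_cst.
apply: (cvg_trans _ (derivative_ge0_cvg fv)).
apply: cvg_app => A tA.
exact: (@filterS _ (nbhs t) _ (fun s => 0 <= s -> A s)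
  (fun s => s != t -> 0 <= s -> A s) (fun _ H _ => H) tA).
Qed.

Lemma derivative_ge0_sum (R : realType) (I : finType) (f : I -> R -> R)
    (v : I -> R) (t : R) :
  (forall i, derivative_ge0 (f i) t (v i)) ->
  derivative_ge0 (fun s => \sum_i f i s) t (\sum_i v i).
Proof.
move=> fv; rewrite /derivative_ge0.
under eq_cvg do rewrite -sumrB mulr_sumr.
apply: cvg_big => [|i _]; last exact: fv.
exact: add_continuous.
Qed.

Lemma gronwall_eq0 (R : realType) (f f' : R -> R) (T K : R) :
  0 <= T -> (forall t : R, 0 <= t -> derivative_ge0 f t (f' t)) ->
  (forall t : R, 0 <= f t) -> f 0 = 0 ->
  (forall t : R, 0 < t < T -> f' t <= K * f t) -> f T = 0.
Proof.
move=> T0 ff' f0 f00 fK.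
(* With this integrating factor the differential inequality says that [g] is nonincreasing, so
   [g T <= g 0 = 0]; then [0 <= f T] forces equality. *)
pose g := f * (fun t : R => expR (- K * t)) : R -> R.
have gd (t : R) : 0 < t -> is_derive t 1 g
    (expR (- K * t) * (f' t - K * f t)).
  move=> t0; have H1 := derivative_ge0_is_derive t0 (ff' t (ltW t0)).
  have H2 : is_derive t 1 (fun t : R => expR (- K * t)) (expR (- K * t) * - K).
    have H3 : is_derive t 1 (fun t : R => - K * t) (- K).
      by apply: is_derive_eq; rewrite [LHS]mulr1.
    exact: (is_derive1_comp (is_derive_expR (- K * t)) H3).
  apply: is_derive_eq; rewrite /GRing.scale/=; ring.
suff : g T <= g 0.
  rewrite /g /= /GRing.mul/= f00 mul0r pmulr_lle0 ?expR_gt0// => fT.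
  by apply/eqP; rewrite eq_le fT f0.
apply: (@ler0_derive1_le_cc _ _ 0 T) => //.
- by move=> x; rewrite in_itv/= => /andP[x0 _]; have [] := gd x x0.
- move=> x; rewrite in_itv/= => xT; have /andP[x0 _] := xT.
  rewrite derive1E (@derive_val _ _ _ _ _ _ _ (gd x x0)).
  by rewrite pmulr_rle0 ?expR_gt0// subr_le0 fK.
- move=> x; apply: cvgM; first exact: (derivative_ge0_within_continuous ff').
  apply: continuous_subspaceT => {}x.
  apply: continuous_comp; last exact: continuous_expR.
  by apply: cvgM; [exact: cvg_cst|exact: cvg_id].
- by rewrite in_itv/= lexx andbT.
- by rewrite in_itv/= lexx.
Qed.

(** Gronwall is applied to the sum of the squares, which is differentiable where a sum of absolute
    values need not be. *)
Lemma linear_growth_eq0 (R : realType) (I : finType) (f f' : I -> R -> R) :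
  (forall i (t : R), 0 <= t -> derivative_ge0 (f i) t (f' i t)) ->
  (forall i, f i 0 = 0) ->
  (forall i (T : R), 0 <= T -> exists K, forall t : R, 0 <= t <= T ->
     `|f' i t| <= K * \sum_k `|f k t|) ->
  forall i (t : R), 0 <= t -> f i t = 0.
Proof.
move=> ff' f0 fK i T T0.
have [K HK] := boolp.choice (fun j => fK j T T0).
pose K1 := \sum_j `|K j|.
have K10 : 0 <= K1 by apply: sumr_ge0.
have {}HK j t : 0 <= t <= T -> `|f' j t| <= K1 * \sum_k `|f k t|.
  move=> /(HK j)/le_trans; apply; apply: ler_wpM2r; first exact: sumr_ge0.
  by rewrite /K1 (bigD1 j)//= (le_trans (ler_norm _))// lerDl sumr_ge0.
suff : \sum_k f k T ^+ 2 = 0.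
  move=> /eqP; rewrite psumr_eq0; last by move=> k _; exact: sqr_ge0.
  by move=> /allP/(_ i (mem_index_enum i)) /=; rewrite sqrf_eq0 => /eqP.
(* From [2 |f j| |f k| <= f j ^+ 2 + f k ^+ 2], the derivative is at most [K1] times a double sum in
   which every square occurs [2 * #|I|] times. *)
apply: (@gronwall_eq0 _ (fun t => \sum_k f k t ^+ 2)
  (fun t => \sum_k f' k t * (f k t *+ 2)) T (2 * K1 * #|I|%:R)) => //.
- by move=> t t0; apply: derivative_ge0_sum => k; exact/derivative_ge0_sqr/ff'.
- by move=> t; apply: sumr_ge0 => k _; exact: sqr_ge0.
- by rewrite big1// => k _; rewrite f0 expr0n.
move=> t /andP[t0 tT]; have tT' : 0 <= t <= T by rewrite !ltW.
apply: (@le_trans _ _ (\sum_j \sum_k K1 * (f j t ^+ 2 + f k t ^+ 2))).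
  apply: ler_sum => j _; rewrite mulrnAr -mulr_natr.
  apply: (@le_trans _ _ (`|f' j t| * `|f j t| * 2)).
    by apply: ler_wpM2r => //; rewrite -normrM ler_norm.
  apply: (@le_trans _ _ (K1 * (\sum_k `|f k t|) * `|f j t| * 2)).
    by do 2 apply: ler_wpM2r => //; exact: HK.
  rewrite -!mulrA -mulr_sumr ler_wpM2l// mulr_suml ler_sum// => k _.
  rewrite -(real_normK (num_real (f j t))) -(real_normK (num_real (f k t))).
  have := sqr_ge0 (`|f j t| - `|f k t|); nra.
under eq_bigr do rewrite -mulr_sumr big_split/= sumr_const.
rewrite -mulr_sumr big_split/= sumrMnl sumr_const -mulrnDl -mulr_natr.
by rewrite le_eqVlt; apply/orP; left; apply/eqP; ring.
Qed.

(** * Deviation from scalar matrices *)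

(** The entrywise l1 norm, which is submultiplicative and dominates both the entries and the
    trace. *)
Definition absum (R : realType) (m n : nat) (M : 'M[R]_(m, n)) : R :=
  \sum_i \sum_j `|M i j|.

Lemma absum_ge0 (R : realType) (m n : nat) (M : 'M[R]_(m, n)) : 0 <= absum M.
Proof. by apply: sumr_ge0 => i _; exact: sumr_ge0. Qed.

Lemma absum_entry (R : realType) (m n : nat) (M : 'M[R]_(m, n)) i j :
  `|M i j| <= absum M.
Proof.
rewrite /absum (bigD1 i)//= (bigD1 j)//= -addrA lerDl addr_ge0 ?sumr_ge0//.
by move=> k _; exact: sumr_ge0.
Qed.

Lemma absum_trmx (R : realType) (m n : nat) (M : 'M[R]_(m, n)) :
  absum M^T = absum M.
Proof.
rewrite /absum exchange_big/=; apply: eq_bigr => i _; apply: eq_bigr => j _.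
by rewrite mxE.
Qed.

Lemma absumZ (R : realType) (m n : nat) (a : R) (M : 'M[R]_(m, n)) :
  absum (a *: M) = `|a| * absum M.
Proof.
rewrite /absum mulr_sumr; apply: eq_bigr => i _.
by rewrite mulr_sumr; apply: eq_bigr => j _; rewrite mxE normrM.
Qed.

Lemma absumD_le (R : realType) (m n : nat) (A B : 'M[R]_(m, n)) :
  absum (A + B) <= absum A + absum B.
Proof.
rewrite /absum -big_split; apply: ler_sum => i _ /=.
by rewrite -big_split; apply: ler_sum => j _ /=; rewrite mxE ler_normD.
Qed.

Lemma absumM_le (R : realType) (m n p : nat) (A : 'M[R]_(m, n))
    (B : 'M[R]_(n, p)) : absum (A *m B) <= absum A * absum B.
Proof.
rewrite /absum mulr_suml; apply: ler_sum => i _.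
apply: (@le_trans _ _ (\sum_k \sum_j `|A i j| * `|B j k|)).
  apply: ler_sum => k _; rewrite mxE (le_trans (ler_norm_sum _ _ _))//.
  by apply: ler_sum => j _; rewrite normrM.
rewrite exchange_big/= mulr_suml; apply: ler_sum => j _.
rewrite -mulr_sumr ler_wpM2l// (bigD1 j)//= lerDl sumr_ge0// => k _.
exact: sumr_ge0.
Qed.

Lemma absum_tr_le (R : realType) (n : nat) (M : 'M[R]_n) : `|\tr M| <= absum M.
Proof.
rewrite (le_trans (ler_norm_sum _ _ _))// ler_sum// => i _.
by rewrite (bigD1 i)//= lerDl sumr_ge0.
Qed.

(* Subtracting the corner entry rather than the mean of the diagonal avoids a
   division, and vanishes on the same matrices. *)
Definition scalar_defect (R : realType) (d : nat) (M : 'M[R]_d.+1) : 'M[R]_d.+1 :=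
  M - (M 0 0)%:M.

Lemma scalar_defect_eq0 (R : realType) (d : nat) (M : 'M[R]_d.+1) :
  scalar_defect M = 0 -> M = (M 0 0)%:M.
Proof. by move/eqP; rewrite subr_eq0 => /eqP. Qed.

Lemma scalar_defect_scalar (R : realType) (d : nat) (a : R) :
  scalar_defect (a%:M : 'M[R]_d.+1) = 0.
Proof. by rewrite /scalar_defect mxE eqxx mulr1n subrr. Qed.

Lemma scalar_defectZ (R : realType) (d : nat) (a : R) (M : 'M[R]_d.+1) :
  scalar_defect (a *: M) = a *: scalar_defect M.
Proof. by rewrite /scalar_defect mxE scalerBr scale_scalar_mx. Qed.

Lemma scalar_defect_trmx (R : realType) (d : nat) (M : 'M[R]_d.+1) :
  scalar_defect M^T = (scalar_defect M)^T.
Proof. by rewrite /scalar_defect mxE linearB/= tr_scalar_mx. Qed.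

(** Split [A] into its defect and the scalar matrix [A 0 0]. Each resulting term contains the defect
    of one factor, as an induction over products requires. *)
Lemma scalar_defectM (R : realType) (d : nat) (A B : 'M[R]_d.+1) :
  scalar_defect (A *m B) =
  scalar_defect (scalar_defect A *m B) + A 0 0 *: scalar_defect B.
Proof.
rewrite -scalar_defectZ /scalar_defect -mul_scalar_mx.
rewrite addrACA -opprD -mulmxDl subrK; congr (_ - _).
by rewrite -[in LHS](subrK (A 0 0)%:M A) mulmxDl mxE raddfD.
Qed.

(** The constant is 1 for [M] itself plus [d.+1], the l1 norm of the identity. *)
Lemma absum_scalar_defect_le (R : realType) (d : nat) (M : 'M[R]_d.+1) :
  absum (scalar_defect M) <= d.+2%:R * absum M.
Proof.
have -> : scalar_defect M = M + (- M 0 0) *: 1%:M.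
  by rewrite /scalar_defect scalemx1 raddfN.
rewrite (le_trans (absumD_le _ _))// absumZ normrN.
have -> : absum (1%:M : 'M[R]_d.+1) = d.+1%:R.
  rewrite /absum -[d.+1 in RHS]card_ord -sum1_card natr_sum.
  apply: eq_bigr => i _; rewrite (bigD1 i)//= big1 ?addr0 ?mxE ?eqxx ?normr1//.
  by move=> j /negPf; rewrite eq_sym mxE => ->; rewrite normr0.
by rewrite -[d.+2%:R]natr1 mulrDl mul1r addrC mulrC lerD2r ler_wpM2l ?absum_entry.
Qed.

(** [C] is fixed before [F], so that one constant serves all times of a bounded interval. The bound
    on the product itself feeds the induction for the defect. *)
Lemma prod_scalar_defect_le (R : realType) (I : finType) (d : nat) (s : seq I)
    (B : R) :
  exists2 C, 0 <= C & forall F : I -> 'M[R]_d.+1, (forall i, absum (F i) <= B) ->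
    absum (\prod_(i <- s) F i) <= C /\
    absum (scalar_defect (\prod_(i <- s) F i)) <=
      C * \sum_i absum (scalar_defect (F i)).
Proof.
elim: s => [|j s [C C0 IH]].
  exists (absum (1%:M : 'M[R]_d.+1)); first exact: absum_ge0.
  move=> F _; rewrite big_nil; split => //.
  rewrite (scalar_defect_scalar d 1) -[X in absum X](scale0r 0) absumZ normr0 mul0r.
  by rewrite mulr_ge0 ?absum_ge0// sumr_ge0// => i _; exact: absum_ge0.
(* The first summand covers the product and the term [F j 0 0 *: scalar_defect P]; the second covers
   the defect of [scalar_defect (F j) *m P]. *)
exists (`|B| * C + d.+2%:R * C); first by rewrite addr_ge0// mulr_ge0.
move=> F FB; have [PC DC] := IH F FB; rewrite big_cons.
have FjB : absum (F j) <= `|B| by rewrite (le_trans (FB j)) ?ler_norm.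
set P := \prod_(i <- s) F i in PC DC *; rewrite -[_ * P]/(F j *m P).
set S := \sum_i _ in DC *.
have jS : absum (scalar_defect (F j)) <= S.
  by rewrite /S (bigD1 j)//= lerDl sumr_ge0// => i _; exact: absum_ge0.
split.
  rewrite (le_trans (absumM_le _ _))// ler_wpDr ?mulr_ge0//.
  by rewrite ler_pM// absum_ge0.
rewrite scalar_defectM (le_trans (absumD_le _ _))// addrC mulrDl lerD//.
  rewrite absumZ -mulrA ler_pM// ?absum_ge0//.
  by rewrite (le_trans (absum_entry _ _ _)).
rewrite (le_trans (absum_scalar_defect_le _))// -mulrA ler_wpM2l//.
by rewrite (le_trans (absumM_le _ _))// mulrC ler_pM ?absum_ge0.
Qed.

(** * The flow of the trace loss *)

Lemma is_derive_half_sqr (R : realType) (e c : R) :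
  is_derive (0 : R) 1 (fun s : R => 2^-1 * (e - s * c) ^+ 2) (- e * c).
Proof.
(* The difference quotient at 0 of this quadratic is affine in [z]. *)
apply/is_derive1_caratheodory; exists (fun z => 2^-1 * (z * c - e *+ 2) * c).
split=> [z||]; first by field.
- apply: cvgM; last exact: cvg_cst.
  apply: cvgM; first exact: cvg_cst.
  apply: cvgB; last exact: cvg_cst.
  by apply: cvgM; [exact: cvg_id|exact: cvg_cst].
- by rewrite mul0r sub0r; field.
Qed.

Lemma mxtrace_mul_delta (R : realType) (d : nat) (M : 'M[R]_d) (a b : 'I_d) :
  \tr (M *m delta_mx a b) = M b a.
Proof.
rewrite /mxtrace (bigD1 b)//= big1 ?addr0 => [|i ib].
  rewrite mxE (bigD1 a)//= big1 ?addr0 => [|i ia]; rewrite mxE ?eqxx ?mulr1//.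
  by rewrite (negPf ia) mulr0.
by rewrite mxE big1// => k _; rewrite mxE (negPf ib) andbF mulr0.
Qed.

Definition trace_loss (R : realType) (d : nat) : 'M[R]_d -> R :=
  loss (fun _ : 'I_1 => 1%:M) (fun _ => d%:R).

Lemma trace_lossE (R : realType) (d : nat) (W : 'M[R]_d) :
  trace_loss W = 2^-1 * (d%:R - \tr W) ^+ 2.
Proof. by rewrite /trace_loss /loss big_ord1 /frob trmx1 mul1mx. Qed.

Lemma trace_loss_eq0 (R : realType) (d : nat) (W : 'M[R]_d) :
  (trace_loss W = 0) <-> (\tr W = d%:R).
Proof.
rewrite trace_lossE; split=> [/eqP|->]; last by rewrite subrr expr0n mulr0.
by rewrite mulf_eq0 invr_eq0 pnatr_eq0/= sqrf_eq0 subr_eq0 => /eqP.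
Qed.

(** The enumeration of the indices is cut at the j-th factor; being duplicate-free, it has the
    changed factor in neither half. The two lists depend on [j] alone. *)
Lemma end_to_end_with (R : realType) (d N : nat) (j : 'I_N) :
  exists p1 p2 : seq 'I_N, forall (Ws : 'I_N -> 'M[R]_d.+1) (Y : 'M[R]_d.+1),
    end_to_end [eta Ws with j |-> Y] =
    (\prod_(i <- p1) Ws i) *m Y *m (\prod_(i <- p2) Ws i).
Proof.
have [p1 [p2 E]] : exists p1 p2, index_enum 'I_N = p1 ++ rev_ord j :: p2.
  by case/splitPr: (mem_index_enum (rev_ord j)) => p1 p2; exists p1, p2.
have := index_enum_uniq 'I_N; rewrite E cat_uniq /= negb_or.
move=> /and3P[_ /andP[jp1 _] /andP[jp2 _]].
exists (map (@rev_ord N) p1), (map (@rev_ord N) p2) => Ws Y.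
rewrite /end_to_end E -[LHS]/(\prod_(i <- p1 ++ rev_ord j :: p2)
  [eta Ws with j |-> Y] (rev_ord i)).
have prodE p : rev_ord j \notin p ->
    \prod_(i <- p) [eta Ws with j |-> Y] (rev_ord i) =
    \prod_(i <- map (@rev_ord N) p) Ws i.
  move=> jp; rewrite big_map; apply: eq_big_seq => i ip /=.
  by case: eqP => // ij; move: jp; rewrite -ij rev_ordK ip.
rewrite big_cat big_cons /= rev_ordK eqxx.
by rewrite (prodE p1)// (prodE p2)//; exact: mulmxA.
Qed.

(* [s] lists the other factors in cyclic order, starting after the j-th one. *)
Lemma partial_grad_trace_loss (R : realType) (d N : nat) (j : 'I_N) :
  exists s : seq 'I_N, forall Ws : 'I_N -> 'M[R]_d.+1,
    partial_grad (deep_loss (@trace_loss R d.+1)) j Ws =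
    (\tr (end_to_end Ws) - d.+1%:R) *: (\prod_(i <- s) Ws i)^T.
Proof.
have [p1 [p2 E]] := @end_to_end_with R d N j.
exists (p2 ++ p1) => Ws; rewrite big_cat /=.
set L := \prod_(i <- p1) _ in E *; set Q := \prod_(i <- p2) _ in E *.
have PE : end_to_end Ws = L *m Ws j *m Q.
  rewrite -E; congr end_to_end; apply/funext => i /=.
  by case: eqP => // ->.
apply/matrixP => a b; rewrite [LHS]mxE [RHS]mxE [X in _ = _ * X]mxE.
(* Cyclicity of the trace turns [\tr (L *m delta_mx a b *m Q)] into the entry [(Q *m L) b a], so the
   loss is quadratic in [s]. *)
have -> : (fun s : R => deep_loss (@trace_loss R d.+1)
      [eta Ws with j |-> Ws j + s *: delta_mx a b]) =
    (fun s => 2^-1 * (d.+1%:R - \tr (end_to_end Ws) - s * (Q *m L) b a) ^+ 2).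
  apply/funext => s; rewrite /deep_loss trace_lossE E PE; congr (_ * _ ^+ 2).
  rewrite mulmxDr mulmxDl raddfD/= opprD addrA; congr (_ - _).
  rewrite -scalemxAr -scalemxAl linearZ /= mxtrace_mulC mulmxA.
  by rewrite mxtrace_mul_delta.
rewrite derive1E (@derive_val _ _ _ _ _ _ _ (is_derive_half_sqr _ _)).
by rewrite opprB.
Qed.

(** The first hypothesis on [u] is linearity in just the shape of a difference quotient. *)
Lemma has_derivative_ge0_linear (R : realType) (d : nat) (u : 'M[R]_d -> R)
    (f : R -> 'M[R]_d) (t : R) (v : 'M[R]_d) :
  (forall (c : R) (A B : 'M[R]_d), u (c *: (A - B)) = c * (u A - u B)) ->
  continuous u -> has_derivative_ge0 f t v ->
  derivative_ge0 (u \o f) t (u v).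
Proof.
move=> uE uc fv; rewrite /derivative_ge0.
under eq_cvg do rewrite -uE.
exact: (cvg_comp _ _ fv (uc v)).
Qed.

Lemma scalar_defect_entry_continuous (R : realType) (d : nat) (a b : 'I_d.+1) :
  continuous (fun M : 'M[R]_d.+1 => scalar_defect M a b).
Proof.
move=> M; rewrite (_ : (fun _ => _) =
    (fun M : 'M[R]_d.+1 => M a b - M 0 0 * (a == b)%:R)); last first.
  by apply/funext => A; rewrite !mxE mulr_natr.
have c i j := @coord_continuous R d.+1 d.+1 i j M.
exact: cvgB (c a b) (cvgM (c 0 0) (cvg_cst _)).
Qed.

(** Being scalar is a closed condition, since the entries of the defect are continuous. This serves
    both limits, in time and in [alpha]. *)
Lemma scalar_defect_cvg (R : realType) (d : nat) (T : Type)
    (F : set_system T) (FF : ProperFilter F) (g : T -> 'M[R]_d.+1)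
    (L : 'M[R]_d.+1) :
  g x @[x --> F] --> L -> (\forall x \near F, scalar_defect (g x) = 0) ->
  scalar_defect L = 0.
Proof.
move=> gL g0; apply/matrixP => a b; rewrite [RHS]mxE.
have H1 := cvg_comp _ _ gL (@scalar_defect_entry_continuous R d a b L).
have H2 : ((fun M => scalar_defect M a b) \o g) x @[x --> F] --> (0 : R).
  apply: cvg_near_cst; apply: filterS g0 => x /= ->; by rewrite mxE.
exact: (cvg_unique _ H1 H2).
Qed.

Lemma big_triple (V : nmodType) (I J K : finType) (F : I * J * K -> V) :
  \sum_i F i = \sum_i \sum_j \sum_k F (i, j, k).
Proof. by rewrite !pair_bigA; apply: eq_bigr => -[[]]. Qed.

(** Each entry is continuous on a compact interval, hence bounded there. *)
Lemma flow_bounded (R : realType) (d N : nat) (Ws : R -> 'I_N -> 'M[R]_d)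
    (V : R -> 'I_N -> 'M[R]_d) (T : R) :
  0 <= T ->
  (forall t j, 0 <= t -> has_derivative_ge0 (Ws ^~ j) t (V t j)) ->
  exists B, forall t, 0 <= t <= T -> forall j, absum (Ws t j) <= B.
Proof.
move=> T0 WV.
have entry (i : 'I_N * 'I_d * 'I_d) :
    exists K, forall t, 0 <= t <= T -> `|Ws t i.1.1 i.1.2 i.2| <= K.
  case: i => [[j a] b] /=.
  have c : {within `[0, T], continuous (fun t => `|Ws t j a b|)}.
    have c1 : {within `[0, T], continuous (fun t => Ws t j a b)}.
      apply: (@derivative_ge0_within_continuous _ _ (fun t => V t j a b)) => t t0.
      apply: (has_derivative_ge0_linear _ (@coord_continuous R d d a b) (WV t j t0)).
      by move=> k A B; rewrite !mxE.
    by move=> t; apply: cvg_norm; exact: c1.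
  have [t _ tmax] := EVT_max T0 c.
  by exists `|Ws t j a b| => s sT; apply: tmax; rewrite in_itv.
have [K HK] := boolp.choice entry.
exists (\sum_i `|K i|) => t tT j.
rewrite big_triple (bigD1 j)//=.
rewrite ler_wpDr//.
  by apply: sumr_ge0 => i _; apply: sumr_ge0 => a _; exact: sumr_ge0.
apply: ler_sum => a _; apply: ler_sum => b _.
exact: le_trans (HK (j, a, b) t tT) (ler_norm _).
Qed.

(** The entries of all defects form one finite family of functions, indexed by factor, row and
    column, that starts at 0. Its velocities are entries of a multiple of the defect of a transposed
    product of factors, so they are linearly bounded by the family on bounded intervals. *)
Lemma gradient_flow_scalar (R : realType) (d N : nat) (alpha : R)
    (Ws : R -> 'I_N -> 'M[R]_d.+1) :
  gradient_flow (@trace_loss R d.+1) alpha Ws ->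
  forall t j, 0 <= t -> scalar_defect (Ws t j) = 0.
Proof.
move=> [W0 WV] t j t0; apply/matrixP => a b; rewrite [RHS]mxE.
pose f (i : 'I_N * 'I_d.+1 * 'I_d.+1) s := scalar_defect (Ws s i.1.1) i.1.2 i.2.
pose f' (i : 'I_N * 'I_d.+1 * 'I_d.+1) s := scalar_defect
  (- partial_grad (deep_loss (@trace_loss R d.+1)) i.1.1 (Ws s)) i.1.2 i.2.
apply: (@linear_growth_eq0 R _ f f' _ _ _ (j, a, b) t t0).
- move=> [[{}j {}a] {}b] {t0}t t0.
  apply: (has_derivative_ge0_linear _
    (@scalar_defect_entry_continuous R d a b) (WV t j t0)) => c A B.
  by rewrite !mxE; case: (a == b); rewrite ?mulr1n ?mulr0n; ring.
- by move=> i; rewrite /f W0 scalar_defect_scalar mxE.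
move=> [[{}j {}a] {}b] T T0.
have [B HB] := flow_bounded T0 WV.
have [s gradE] := @partial_grad_trace_loss R d N j.
have [C C0 HC] := prod_scalar_defect_le d s B.
have [C' C'0 HC'] := prod_scalar_defect_le d (map (@rev_ord N) (index_enum 'I_N)) B.
(* [C'] bounds the trace of the full product, [d.+1] is the label, and [C] controls the defect of
   the product of the other factors. *)
exists ((C' + d.+1%:R) * C) => r rT.
have -> : \sum_k `|f k r| = \sum_i absum (scalar_defect (Ws r i)).
  exact: big_triple.
rewrite /f' /= gradE -scaleNr (le_trans (absum_entry _ _ _))//.
rewrite scalar_defectZ absumZ normrN scalar_defect_trmx absum_trmx -mulrA.
have [_ DC] := HC _ (HB r rT).
apply: ler_pM => //; first exact: absum_ge0.
rewrite (le_trans (ler_normB _ _))// normr_nat lerD2r.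
rewrite (le_trans (absum_tr_le _))//.
have [PC _] := HC' _ (HB r rT).
by move: PC; rewrite big_map.
Qed.

Lemma is_W_deep_bar_trace_loss (R : realType) (d N : nat) (Wbar : 'M[R]_d.+1) :
  is_W_deep_bar N (@trace_loss R d.+1) Wbar -> scalar_defect Wbar = 0.
Proof.
move=> [Winf Winf_lim WinfL]; apply: (scalar_defect_cvg _ WinfL).
apply: filterS Winf_lim => alpha [Ws flow WsL].
apply: (scalar_defect_cvg _ WsL).
have : \forall t \near +oo, (0 : R) <= t by exact: nbhs_pinfty_ge.
apply: filterS => t t0.
have W0 j := gradient_flow_scalar flow j t0.
(* At a fixed time any bound on the factors will do: all their defects vanish, so the estimate reads
   [C * 0]. *)
have [C _ HC] := prod_scalar_defect_le d (map (@rev_ord N) (index_enum 'I_N))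
  (\sum_j absum (Ws t j)).
have [|_] := HC (Ws t).
  by move=> j; rewrite (bigD1 j)//= lerDl sumr_ge0// => i _; exact: absum_ge0.
rewrite [X in _ * X]big1 ?mulr0 => [|j _]; last first.
  by rewrite W0 -(scale0r 0) absumZ normr0 mul0r.
rewrite big_map -[\prod_(i <- _) _]/(end_to_end (Ws t)) => D0.
apply/matrixP => a b; apply/eqP; rewrite [X in _ == X]mxE -normr_le0.
exact: le_trans (absum_entry _ _ _) D0.
Qed.

(** * Perturbing the identity *)

Lemma powR_lt_tangent1 (R : realType) (p x : R) :
  0 < p < 1 -> 0 < x -> x != 1 -> x `^ p < 1 + p * (x - 1).
Proof.
move=> /andP[p0 p1] x0 x1; rewrite /powR gt_eqF//.
have s0 : ln x != 0 by rewrite ln_eq0.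
set s := ln x in s0 *; rewrite -[x in X in _ < X](lnK x0) -/s.
have H1 : 1 + (1 - p) * s < expR ((1 - p) * s).
  by apply: expR_gt1Dx; rewrite mulf_neq0// subr_eq0 eq_sym lt_eqF.
have H2 : 1 + - p * s < expR (- p * s).
  by apply: expR_gt1Dx; rewrite mulf_neq0// oppr_eq0 gt_eqF.
(* In the average of [H2] and [H1] with weights [1 - p] and [p] the terms linear in [s] cancel.
   Multiplying by [expR (p * s)], which is the power of [x], gives the tangent bound. *)
have H : 1 < (1 - p) * expR (- p * s) + p * expR ((1 - p) * s) by nra.
have E1 : expR s = expR (p * s) * expR ((1 - p) * s).
  by rewrite -expRD; congr expR; ring.
have E2 : expR (p * s) * expR (- p * s) = 1.
  by rewrite -expRD -mulrDl subrr mul0r expR0.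
have -> : 1 + p * (expR s - 1) =
    expR (p * s) * ((1 - p) * expR (- p * s) + p * expR ((1 - p) * s)).
  transitivity ((1 - p) * (expR (p * s) * expR (- p * s)) + p * expR s).
    by rewrite E2; ring.
  by rewrite E1; ring.
by rewrite -[ltLHS]mulr1 ltr_pM2l ?expR_gt0.
Qed.

Lemma schatten_diag (R : realType) (d : nat) (p : R) (v : 'rV[R]_d) :
  (forall i, 0 <= v 0 i) ->
  schatten p (diag_mx v) = (\sum_i v 0 i `^ p) `^ p^-1.
Proof.
move=> v0; rewrite /schatten (perm_big _ (singular_values_diag v0)) /=.
by rewrite big_map big_enum.
Qed.

(** Summing the tangent bounds, the linear terms cancel because the entries have mean 1; the entry
    at [i0] makes the inequality strict. *)
Lemma schatten_diag_lt1 (R : realType) (d : nat) (p : R) (v : 'rV[R]_d)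
    (i0 : 'I_d) :
  0 < p < 1 -> (forall i, 0 < v 0 i) -> \sum_i v 0 i = d%:R -> v 0 i0 != 1 ->
  schatten p (diag_mx v) < schatten p (1%:M : 'M[R]_d).
Proof.
move=> p01 v0 vd vi0; have /andP[p0 _] := p01.
rewrite -diag_const_mx !schatten_diag => [|i|i]; rewrite ?mxE ?ler01//; last exact: ltW.
have -> : \sum_i (const_mx 1 : 'rV[R]_d) 0 i `^ p = d%:R.
  under eq_bigr do rewrite mxE powR1.
  by rewrite sumr_const card_ord.
apply: gt0_ltr_powR; rewrite ?invr_gt0 ?nnegrE//.
  by apply: sumr_ge0 => i _; exact: powR_ge0.
have -> : d%:R = \sum_i (1 + p * (v 0 i - 1)) :> R.
  rewrite big_split/= -mulr_sumr sumrB vd !sumr_const card_ord.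
  by rewrite subrr mulr0 addr0.
rewrite (bigD1 i0)// [ltRHS](bigD1 i0)//= ltr_leD//.
  exact: powR_lt_tangent1.
apply: ler_sum => i _; have [->|vi] := eqVneq (v 0 i) 1.
  by rewrite powR1 subrr mulr0 addr0.
exact/ltW/powR_lt_tangent1.
Qed.

Lemma psd_diag (R : realType) (d : nat) (v : 'rV[R]_d) :
  (forall i, 0 <= v 0 i) -> psd (diag_mx v).
Proof.
move=> v0; split; first exact: tr_diag_mx.
move=> x; rewrite mxE; apply: sumr_ge0 => i _.
rewrite mul_mx_diag !mxE mulrAC -expr2; apply: mulr_ge0 => //; exact: sqr_ge0.
Qed.

Lemma scalar1_not_local_min (R : realType) (d : nat) (p : R)
    (F : set 'M[R]_d.+2) :
  0 < p < 1 -> (forall W, psd W -> \tr W = d.+2%:R -> F W) ->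
  ~ local_min F (schatten p) 1%:M.
Proof.
move=> p01 FW [_ min1].
(* This direction is traceless, so [1%:M + e *: D] keeps the trace. *)
pose D : 'M[R]_d.+2 := delta_mx 0 0 - delta_mx 1 1.
pose v (e : R) : 'rV[R]_d.+2 := \row_i (1 + e * D i i).
have vE e : diag_mx (v e) = 1%:M + e *: D.
  apply/matrixP => i j; rewrite !mxE; have [->|ij] := eqVneq i j.
    by rewrite !mulr1n.
  rewrite !mulr0n add0r; case: (eqVneq i 0) => [i0|_] /=.
    by move: ij; rewrite i0 eq_sym => /negPf ->; rewrite subrr mulr0.
  case: (eqVneq i 1) => [i1|_] /=; last by rewrite subrr mulr0.
  by move: ij; rewrite i1 eq_sym => /negPf ->; rewrite subrr mulr0.
have vcvg : (fun e : R => diag_mx (v e)) @ 0^'+ --> (1%:M : 'M[R]_d.+2).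
  rewrite (_ : (fun _ => _) = fun e => 1%:M + e *: D); last exact/funext.
  have e0 : e @[e --> 0^'+] --> (0 : R).
    by apply: cvg_within_filter; exact: cvg_id.
  have := cvgD (cvg_cst (1%:M : 'M[R]_d.+2)) (cvgZr_tmp (a := D) e0).
  by rewrite scale0r addr0 => D0; exact: D0.
have sumv e : \sum_i v e 0 i = d.+2%:R.
  under eq_bigr do rewrite mxE.
  rewrite big_split/= sumr_const card_ord -mulr_sumr -[\sum_i D i i]/(\tr D).
  by rewrite raddfB/= -[delta_mx 0 0]mul1mx -[delta_mx 1 1]mul1mx
    !mxtrace_mul_delta !mxE !eqxx subrr mulr0 addr0.
have min0 := vcvg _ min1.
(* [e < 1] keeps the diagonal positive, and [0 < e] moves the entry at 0 away from 1. *)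
have [e [[e0 e1] minE]] := filter_ex (filterI (filterI
  (nbhs_right_gt (0 : R)) (nbhs_right_lt (@ltr01 R))) min0).
have v0 i : 0 < v e 0 i.
  rewrite !mxE; case: (i == 0); case: (i == 1) => /=; rewrite ?mulr1n ?mulr0n; lra.
have : schatten p (1%:M : 'M[R]_d.+2) <= schatten p (diag_mx (v e)).
  apply: minE; apply: FW; first by apply: psd_diag => i; exact: ltW.
  by rewrite mxtrace_diag.
rewrite leNgt => /negP; apply; apply: (schatten_diag_lt1 (i0 := 0)) => //.
by rewrite !mxE !eqxx /= subr0 mulr1 -subr_eq0 addrC addKr gt_eqF.
Qed.

(** * The trace measurement as a witness *)

Theorem proposition1 (R : realType) (N : nat) (hN : (3 <= N)%N)
    (d : nat) (hd : (3 <= d)%N) :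
  exists (m : nat) (A : 'I_m -> 'M[R]_d) (y : 'I_m -> R),
    [/\ free (codom A),
        (forall i, (A i)^T = A i),
        (forall i j, A i *m A j = A j *m A i),
        (exists2 Wstar : 'M[R]_d, psd Wstar & forall i, y i = frob (A i) Wstar) &
        forall Wbar : 'M[R]_d,
          is_W_deep_bar N (loss A y) Wbar ->
          argmin psd (loss A y) Wbar ->
          loss A y Wbar = 0 ->
          argmin (feasible A y) nuclear_norm Wbar /\
          (forall p : R, 0 < p < 1 ->
             ~ local_min (feasible A y) (schatten p) Wbar)].
Proof.
case: d hd => [|[|[|d]]]// _; clear hN.
exists 1%N, (fun _ => 1%:M), (fun _ => d.+3%:R).
split=> [|i|i j||].
- by rewrite codomE enum_ordSl enum_ord0/= seq1_free oner_neq0.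
- exact: trmx1.
- by [].
- exists 1%:M; last by move=> _; rewrite /frob trmx1 mul1mx mxtrace1.
  by rewrite -diag_const_mx; apply: psd_diag => i; rewrite mxE ler01.
move=> Wbar /is_W_deep_bar_trace_loss/scalar_defect_eq0 Wscal [Wpsd _].
move=> /(proj1 (trace_loss_eq0 _)) Wtr.
have feasE (W : 'M[R]_d.+3) :
    feasible (fun _ : 'I_1 => 1%:M) (fun _ => d.+3%:R) W <->
    psd W /\ \tr W = d.+3%:R.
  by split=> -[pW /(trace_loss_eq0 W)].
split.
  split; first exact/feasE.
  by move=> W /feasE[pW trW]; rewrite !nuclear_norm_psd// Wtr trW.
(* A scalar matrix of size [d.+3] with trace [d.+3] is the identity. *)
move=> p p01; have -> : Wbar = 1%:M.
  have W00 : Wbar 0 0 * d.+3%:R = 1 * d.+3%:R.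
    by rewrite mul1r mulr_natr -mxtrace_scalar -Wscal.
  by rewrite Wscal (mulIf _ W00)// pnatr_eq0.
by apply: scalar1_not_local_min => // W pW trW; exact/feasE.
Qed.
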